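(* Let $\Pi$ be a GSP of an SF instance $I=(A,\succ,c)$. Then every agent $a_i\in A$ is contained in at most one cyclic permutation of $\Pi$ of length greater than 2.
   Context: A Stable Fixtures (SF) instance is $I=(A,\succ,c)$ where $A=\{a_1,\dots,a_n\}$ is a finite set of $n$ agents; each agent $a_i$ has a strict linear order $\succ_i$ over $A\setminus\{a_i\}$ (complete preference list), with the convention that every agent ranks itself last ($a_j\succ_i a_i$ for all $j\neq i$); $a\succeq_i b$ means $a\succ_i b$ or $a=b$. Each agent has an integer capacity $c_i$ with $1\le c_i<n$. A cyclic permutation of a nonempty set $A_r\subseteq A$ is a permutation $\Pi_r$ of $A_r$ consisting of a single cycle of length $|A_r|$ (length 1: a fixed point $(a_i)$; length 2: a transposition $(a_i\ a_j)$). Two cyclic permutations are distinct if some element is mapped to different elements by them. A GSP (generalised stable partition) of $I$ is a finite collection $\Pi=\{\Pi_1,\dots,\Pi_k\}$ of cyclic permutations $\Pi_r$ of sets $A_r\subseteq A$, pairwise distinct except that fixed points may be repeated, such that: (F1) for every $r$ and every $a_j\in A_r$, $\Pi_r(a_j)\succeq_j\Pi_r^{-1}(a_j)$; (F2) there are no distinct $a_i,a_j\in A$ with the transposition $(a_i\ a_j)\notin\Pi$ such that $a_j\succ_i\Pi_r^{-1}(a_i)$ and $a_i\succ_j\Pi_s^{-1}(a_j)$ for some $\Pi_r,\Pi_s\in\Pi$ with $a_i\in A_r$, $a_j\in A_s$; (F3) for every $a_i\in A$, the number of indices $r$ with $a_i\in A_r$ equals $c_i$; (F4) for all distinct $a_i,a_j\in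 A$, $|\{s:\Pi_s(a_i)=a_j\}|+|\{s:\Pi_s(a_j)=a_i\}|\le 2$. *)

(* Defs.v *)
From HB Require Import structures.
From mathcomp Require Import all_boot all_fingroup.
Set Implicit Arguments.
Unset Strict Implicit.
Unset Printing Implicit Defensive.

(* [prefers I a b c] is b >_a c. Together, [prefersI], [prefersT] and
   [prefers_total] make it a strict linear order on all of A; by [self_last]
   it is a complete strict list over A \ {a} with a itself appended at the
   bottom. *)
Record sf_instance (A : finType) := SFInstance {
  prefers : A -> rel A;
  capacity : A -> nat;
  prefersI : forall a, irreflexive (prefers a);
  prefersT : forall a, transitive (prefers a);
  prefers_total : forall a b c, b != c -> prefers a b c || prefers a c b;
  self_last : forall a b, b != a -> prefers a b a;
  capacity_bounds : forall a, 1 <= capacity a < #|A|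
}.

Definition weakly_prefers (A : finType) (I : sf_instance A) (a b c : A) : bool :=
  prefers I a b c || (b == c).

(* A permutation of S is encoded as a permutation of A that is the identity
   outside S. The set S is kept as data: the fixed points (a) and (b) have the
   same underlying permutation of A, namely the identity. *)
Definition is_cyclic (A : finType) (Sp : {set A} * {perm A}) : bool :=
  [&& Sp.1 != set0, perm_on Sp.1 Sp.2
    & [forall x in Sp.1, porbit Sp.2 x == Sp.1]].

Record cyclic_perm (A : finType) := CyclicPerm {
  cyclic_val :> {set A} * {perm A};
  _ : is_cyclic cyclic_val
}.
HB.instance Definition _ (A : finType) := [isSub for @cyclic_val A].
HB.instance Definition _ (A : finType) := [Finite of cyclic_perm A by <:].

Definition support_of (A : finType) (p : cyclic_perm A) : {set A} :=
  (val p).1.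
Definition perm_of (A : finType) (p : cyclic_perm A) : {perm A} :=
  (val p).2.
Definition cycle_length (A : finType) (p : cyclic_perm A) : nat :=
  #|support_of p|.

Definition succ_in (A : finType) (p : cyclic_perm A) (a : A) : A :=
  perm_of p a.
Definition pred_in (A : finType) (p : cyclic_perm A) (a : A) : A :=
  (perm_of p)^-1%g a.

Definition is_transposition (A : finType) (p : cyclic_perm A) (a b : A) : bool :=
  (support_of p == [set a; b]) && (perm_of p == tperm a b).

Definition maps_to (A : finType) (p : cyclic_perm A) (a b : A) : bool :=
  (a \in support_of p) && (succ_in p a == b).

(* The collection is an indexed family, so that fixed points can occur with
   multiplicity. *)
Record is_gsp (A : finType) (I : sf_instance A) (k : nat)
    (Pi : 'I_k -> cyclic_perm A) : Prop := IsGSP {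
  gsp_distinct : forall r s : 'I_k,
    r != s -> Pi r = Pi s -> cycle_length (Pi r) = 1;
  gsp_F1 : forall (r : 'I_k) (a : A), a \in support_of (Pi r) ->
    weakly_prefers I a (succ_in (Pi r) a) (pred_in (Pi r) a);
  gsp_F2 : ~ exists a b : A,
    [/\ a != b,
        ~ (exists r : 'I_k, is_transposition (Pi r) a b)
      & exists r s : 'I_k,
          [/\ a \in support_of (Pi r), b \in support_of (Pi s),
              prefers I a b (pred_in (Pi r) a)
            & prefers I b a (pred_in (Pi s) b)]];
  gsp_F3 : forall a : A,
    #|[set r : 'I_k | a \in support_of (Pi r)]| = capacity I a;
  gsp_F4 : forall a b : A, a != b ->
    #|[set s : 'I_k | maps_to (Pi s) a b]|
      + #|[set s : 'I_k | maps_to (Pi s) b a]| <= 2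
}.

(* Main.v *)
Require Import Defs.
From HB Require Import structures.
From mathcomp Require Import all_boot all_fingroup.
Set Implicit Arguments.
Unset Strict Implicit.
Unset Printing Implicit Defensive.

(** Suppose [a] lies in two long cycles [r] and [s] and has distinct
    predecessors there, and let [p] be the one [a] prefers, say its predecessor
    in [r]. Then [a] prefers [p] to its predecessor in [s], while [p] strictly
    prefers its successor [a] to its predecessor in [r], by (F1) and because [r]
    is long; as (F4) forbids a transposition [(p a)] next to the arc from [p] to
    [a], the pair [{p, a}] violates (F2). Hence two long cycles through [a] share
    the predecessor of [a], and following predecessors shows that they are
    equal. *)

Section CyclicPerm.

Variables (A : finType) (p : cyclic_perm A).

Lemma perm_on_support : perm_on (support_of p) (Defs.perm_of p).
Proof. by case: p => v pP; case/and3P: (pP). Qed.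

Lemma porbit_support a : a \in support_of p ->
  porbit (Defs.perm_of p) a = support_of p.
Proof.
move=> ap; apply/eqP; move: a ap; case: p => v pP.
by case/and3P: (pP) => _ _ /forall_inP.
Qed.

Lemma succ_in_support a : (succ_in p a \in support_of p) = (a \in support_of p).
Proof. exact: perm_closed perm_on_support. Qed.

Lemma pred_inK : cancel (pred_in p) (succ_in p).
Proof. exact: permKV. Qed.

Lemma pred_in_support a : (pred_in p a \in support_of p) = (a \in support_of p).
Proof. by rewrite -succ_in_support pred_inK. Qed.

Lemma pred_in_out a : a \notin support_of p -> pred_in p a = a.
Proof.
move=> /(out_perm perm_on_support) pa.
by rewrite /pred_in -{1}pa permK.
Qed.

(** If the two agreed, two steps along the cycle would lead from [a] back to [a], although the first
    three iterates of [a] are distinct. *)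
Lemma succ_in_neq_pred_in a : a \in support_of p -> 2 < cycle_length p ->
  succ_in p a != pred_in p a.
Proof.
move=> ap; rewrite /cycle_length -(porbit_support ap) => lt2; apply/eqP => eq_sp.
have ssa : succ_in p (succ_in p a) = a by rewrite eq_sp pred_inK.
have := uniq_traject_porbit (Defs.perm_of p) a; move: lt2.
case: #|_| => [|[|[|n]]] //= _.
by rewrite -/(succ_in p a) -/(succ_in p _) ssa !inE eqxx !orbT.
Qed.

Lemma pred_in_neq a : a \in support_of p -> 2 < cycle_length p ->
  pred_in p a != a.
Proof.
move=> ap /(succ_in_neq_pred_in ap); apply: contra_neq => eq_pa.
by rewrite -{1}eq_pa pred_inK eq_pa.
Qed.

(** Induction backwards along the cycle: the orbit of [a] under the inverse permutation is the whole
    support. *)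
Lemma support_pred_ind (P : A -> Prop) a : a \in support_of p -> P a ->
  (forall b, b \in support_of p -> P b -> P (pred_in p b)) ->
  forall b, b \in support_of p -> P b.
Proof.
move=> ap Pa Ppred b; rewrite -(porbit_support ap) -porbitV.
case/porbitP=> n ->{b}.
suff [] : ((Defs.perm_of p)^-1 ^+ n)%g a \in support_of p
    /\ P (((Defs.perm_of p)^-1 ^+ n)%g a) by [].
elim: n => [|n [bp Pb]]; first by rewrite expg0 perm1.
by rewrite expgSr permM; split; [rewrite pred_in_support | apply: Ppred].
Qed.

End CyclicPerm.

(** Agreement on common elements suffices: walking back from [a] along either cycle never leaves the
    other support, so the supports coincide. *)
Lemma cyclic_perm_eq_pred (A : finType) (p q : cyclic_perm A) a :
  a \in support_of p -> a \in support_of q ->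
  (forall b, b \in support_of p -> b \in support_of q ->
    pred_in p b = pred_in q b) ->
  p = q.
Proof.
move=> ap aq eq_pred.
have pq b : b \in support_of p -> b \in support_of q.
  move: b; apply: (support_pred_ind ap aq) => b bp bq.
  by rewrite eq_pred // pred_in_support.
have qp b : b \in support_of q -> b \in support_of p.
  move: b; apply: (support_pred_ind aq ap) => b bq bp.
  by rewrite -eq_pred // pred_in_support.
have eq_supp : support_of p = support_of q.
  by apply/setP=> b; apply/idP/idP => [/pq | /qp].
have eq_perm : Defs.perm_of p = Defs.perm_of q.
  apply: invg_inj; apply/permP=> b; rewrite -!/(pred_in _ b).
  have [bp | bNp] := boolP (b \in support_of p); first exact: eq_pred (pq b bp).
  by rewrite !pred_in_out // -eq_supp.
apply: val_inj; move: eq_supp eq_perm; rewrite /support_of /Defs.perm_of.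
by case: (val p) (val q) => [? ?] [? ?] /= -> ->.
Qed.

Section LongCycles.

Variables (A : finType) (I : sf_instance A) (k : nat) (Pi : 'I_k -> cyclic_perm A).
Hypothesis gspPi : is_gsp I Pi.

Lemma no_transposition_pred r t a : a \in support_of (Pi r) ->
  2 < cycle_length (Pi r) -> ~~ is_transposition (Pi t) (pred_in (Pi r) a) a.
Proof.
set p := pred_in _ a => ar long_r; apply/negP => /andP[/eqP supp_t /eqP perm_t].
have pr : p \in support_of (Pi r) by rewrite pred_in_support.
(* The lengths differ, so [r] and [t] count as two arcs from [p] to [a]; the arc of [t] from [a] to
   [p] is the third. *)
have neq_rt : r != t.
  apply: contraTneq long_r => ->; rewrite /cycle_length supp_t cards2.
  by case: (_ != _).
have neq_pa : p != a by apply: pred_in_neq.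
have := gsp_F4 gspPi neq_pa; apply/negP; rewrite -ltnNge.
have rt_sub : [set r; t] \subset [set s | maps_to (Pi s) p a].
  apply/subsetP=> s; rewrite !inE => /orP[] /eqP->.
    by rewrite /maps_to pr pred_inK eqxx.
  by rewrite /maps_to supp_t set21 /succ_in perm_t tpermL eqxx.
have t_sub : [set t] \subset [set s | maps_to (Pi s) a p].
  rewrite sub1set inE /maps_to supp_t set22.
  by rewrite /succ_in perm_t tpermR eqxx.
move: (leq_add (subset_leq_card rt_sub) (subset_leq_card t_sub)).
by rewrite cards1 cards2 neq_rt.
Qed.

Lemma not_prefers_pred_in r s a :
  a \in support_of (Pi r) -> a \in support_of (Pi s) ->
  2 < cycle_length (Pi r) ->
  ~~ prefers I a (pred_in (Pi r) a) (pred_in (Pi s) a).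
Proof.
set p := pred_in (Pi r) a => ar as_ long_r; apply/negP => pref_p.
have pr : p \in support_of (Pi r) by rewrite pred_in_support.
(* (F1) at [p], whose successor is [a]; the length of the cycle excludes equality. *)
have pref_a : prefers I p a (pred_in (Pi r) p).
  have := gsp_F1 gspPi pr; rewrite /weakly_prefers.
  by rewrite (negPf (succ_in_neq_pred_in pr long_r)) orbF pred_inK.
apply: (gsp_F2 gspPi); exists p, a; split; last by exists r, s; split.
  exact: pred_in_neq.
by case=> t; apply/negP; apply: no_transposition_pred.
Qed.

Lemma long_pred_in_eq r s a :
  a \in support_of (Pi r) -> a \in support_of (Pi s) ->
  2 < cycle_length (Pi r) -> 2 < cycle_length (Pi s) ->
  pred_in (Pi r) a = pred_in (Pi s) a.
Proof.
move=> ar as_ long_r long_s; apply/eqP/negPn/negP => /(prefers_total I a).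
(* Both strict preferences are excluded, with [r] and [s] in either order. *)
by rewrite !(negPf (not_prefers_pred_in _ _ _)).
Qed.

End LongCycles.

Theorem theorem5 (A : finType) (I : sf_instance A) (k : nat)
    (Pi : 'I_k -> cyclic_perm A) (hPi : is_gsp I Pi) (a : A) :
  #|[set r : 'I_k | (a \in support_of (Pi r)) && (2 < cycle_length (Pi r))]| <= 1.
Proof.
apply/card_le1_eqP=> r s; rewrite !inE => /andP[ar long_r] /andP[as_ long_s].
have eq_rs : Pi r = Pi s.
  by apply: (cyclic_perm_eq_pred ar as_) => b br bs; apply: (long_pred_in_eq hPi).
(* Distinct indices can share a cycle only if it has length 1. *)
by apply: contraTeq long_s => /(gsp_distinct hPi)/(_ (esym eq_rs)) ->.
Qed.
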